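(* Suppose Assumptions 2 and 4 (listed in the context) hold, and suppose there exist $\mathbf{c}_0,\mathbf{X}_0$ satisfying the constraints of problem RcMPC at time $i=0$ with the initial seed $\mathbf{c}^0_0$. Then the problem RcMPC is feasible at each iteration of Algorithm 3, for all times $i\ge0$.
   Context: System: $x_{i+1}=f(x_i,u_i)+w_i$, $w_i\in\mathcal{W}$, with $x_i\in\mathbb{R}^{n_x}$, $u_i\in\mathbb{R}^{n_u}$, $x_0=x_{\mathrm{init}}$, $w_i$ an unknown disturbance and $\mathcal{W}\subset\mathbb{R}^{n_x}$ a known compact set; $\mathcal{X}\subset\mathbb{R}^{n_x}$, $\mathcal{U}\subset\mathbb{R}^{n_u}$ are compact polytopic sets. A reference $(x^r_i,u^r_i)_{i\ge0}$ with $x^r_{i+1}=f(x^r_i,u^r_i)$ is given. Notation: $\|x\|_Q^2=x^TQx$; $[z]_j,[A]_j$ are the $j$th element/row; $\oplus$ is Minkowski sum; $N\ge1$ is the horizon; vector inequalities are elementwise; $K$ is a given feedback gain; $[\bar w]_j=\max_{w\in\mathcal{W}}[w]_j$, $[\underline w]_j=\min_{w\in\mathcal{W}}[w]_j$. Assumption 2: $f:\mathcal{X}\times\mathcal{U}\to\mathbb{R}^{n_x}$ is differentiable and componentwise convex. Assumption 4: (a) $x_i$ is known at each time $i$. (b) $\mathcal{X}_N\subseteq\mathbb{R}^{2n_x}$ is known such that, for all $(\underline{x}_N,\bar{x}_N)\in\mathcal{X}_N$ and all $x\in X(\underline{x}_N,\bar{x}_N):=\{x:\underline{x}_N\le x\le\bar{x}_N\}$: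 (i) $x^r_i\in X(\underline{x}_N,\bar{x}_N)$ and $u^r_i\in\mathcal{U}$ for all $i\ge N$; (ii) $X(\underline{x}_N,\bar{x}_N)\subseteq\mathcal{X}$ and $(\underline{x}_N^+,\bar{x}_N^+)\in\mathcal{X}_N$ where, for all $i\ge N$, $[\bar{x}_N^+]_j\ge[f(x,\kappa_i(x))]_j+[\bar w]_j$, $[\underline{x}_N^+]_j\le[f(x,\kappa_i(x))]_j+[\underline w]_j$, $j=1,\ldots,n_x$; (iii) $\kappa_i(x):=K(x-x^r_i)+u^r_i\in\mathcal{U}$ for all $i\ge N$. (c) $Q,R,Q_N\succ0$ and the system with $u_i=K(x_i-x^r_i)+u^r_i$ satisfies, for all $i\ge N$, for some $\beta\ge0$ and some $(\underline{x}_N,\bar{x}_N)\in\mathcal{X}_N$, $\|x_i-x^r_i\|_{Q_N}^2-\|x_{i+1}-x^r_{i+1}\|_{Q_N}^2\ge\|x_i-x^r_i\|_Q^2+\|u_i-u^r_i\|_R^2-\beta$ for all $x_i\in X(\underline{x}_N,\bar{x}_N)$. Algorithm 2 (seed tube and linearization), given $x_i$ and $\mathbf{c}^0_i=\{c^0_{0|i},\ldots,c^0_{N-1|i}\}$: set $X^0_{0|i}=\{x_i\}$. For $k=0,\ldots,N-1$ and $j=1,\ldots,n_x$: let $x^0_{k|i,j}\in\arg\min_{x\in X^0_{k|i}}[f(x,Kx+c^0_{k|i})]_j$, $u^0_{k|i,j}=Kx^0_{k|i,j}+c^0_{k|i}$; let $[A_{k|i}]_j=\partial[f]_j/\partial x$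 and $[B_{k|i}]_j=\partial[f]_j/\partial u$ at $(x^0_{k|i,j},u^0_{k|i,j})$; set $[\bar x_{k+1|i}]_j=\max_{x\in X^0_{k|i}}[f(x,Kx+c^0_{k|i})]_j+[\bar w]_j$, $[\underline x_{k+1|i}]_j=[f(x^0_{k|i,j},u^0_{k|i,j})]_j+[\underline w]_j$; and $X^0_{k+1|i}=\{x:\underline x_{k+1|i}\le x\le\bar x_{k+1|i}\}$. The seed tube is $\mathbf{X}^0_i=\{X^0_{0|i},\ldots,X^0_{N|i}\}$. Problem RcMPC at time $i$, given $\mathbf{c}^0_i$ and the output of Algorithm 2: over $\mathbf{c}_i=\{c_{0|i},\ldots,c_{N-1|i}\}$ and $\mathbf{X}_i=\{X_{0|i},\ldots,X_{N|i}\}$ with $X_{k|i}=\{x:\underline x_{k|i}\le x\le\bar x_{k|i}\}$, minimize $$J_{\mathrm{RcMPC}}(\mathbf{c}_i,\mathbf{X}_i,\mathbf{c}^0_i)=\max_{x\in X_{N|i}}\|x-x^r_{N+i}\|_{Q_N}^2+\sum_{k=0}^{N-1}\max_{x\in X_{k|i}}\big[\|x-x^r_{k+i}\|_Q^2+\|Kx+c_{k|i}+c^0_{k|i}-u^r_{k+i}\|_R^2\big]$$ subject to, for $k=0,\ldots,N-1$: $X_{k|i}\subseteq\mathcal{X}$; $KX_{k|i}\oplus\{c_{k|i}+c^0_{k|i}\}\subseteq\mathcal{U}$; for all $x\in X_{k|i}$, $j=1,\ldots,n_x$: $[\bar x_{k+1|i}]_j\ge[f(x,Kx+c_{k|i}+c^0_{k|i})]_j+[\bar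 w]_j$ and $[\underline x_{k+1|i}]_j\le[f(x^0_{k|i,j},u^0_{k|i,j})]_j+[A_{k|i}+B_{k|i}K]_j(x-x^0_{k|i,j})+[B_{k|i}]_jc_{k|i}+[\underline w]_j$; $X_{0|i}=\{x_i\}$; $(\underline x_{N|i},\bar x_{N|i})\in\mathcal{X}_N$. An optimal solution is denoted $(\mathbf{c}^*_i,\mathbf{X}^*_i)$. Algorithm 3 (parameters: integer $\mathit{maxiters}\ge1$, threshold $\mathit{tol}$), with initial seed $\mathbf{c}^0_0$: at each time $i=0,1,\ldots$: obtain $x_i$; repeat until $\mathit{maxiters}$ iterations have been performed or $\|\mathbf{c}^*_i\|<\mathit{tol}$: run Algorithm 2 with the current seed $\mathbf{c}^0_i$; solve RcMPC for $(\mathbf{c}^*_i,\mathbf{X}^*_i)$; update $\mathbf{c}^0_i\leftarrow\mathbf{c}^*_i+\mathbf{c}^0_i$. Then apply $u_i=Kx_i+c^0_{0|i}$ to the system and set $\mathbf{c}^0_{i+1}=\{c^0_{1|i},\ldots,c^0_{N-1|i},u^r_{N+i}-Kx^r_{N+i}\}$. *)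

(* Defs.v *)
From HB Require Import structures.
From mathcomp Require Import all_boot all_order all_algebra.
From mathcomp Require Import all_classical all_reals all_analysis.

Set Implicit Arguments.
Unset Strict Implicit.
Unset Printing Implicit Defensive.

Import Order.TTheory GRing.Theory Num.Theory.
Import numFieldNormedType.Exports.

Local Open Scope classical_set_scope.
Local Open Scope ring_scope.

Section Generic.
Context {R : realType}.

Definition box n (lo hi : 'cV[R]_n) : set 'cV[R]_n :=
  [set x | forall j, lo j 0 <= x j 0 <= hi j 0].

Definition polyhedron n (A : set 'cV[R]_n) : Prop :=
  exists m (H : 'M[R]_(m, n)) (h : 'cV[R]_m),
    A = [set x | forall i, (H *m x) i 0 <= h i 0].

Definition compact_polytope n (A : set 'cV[R]_n) : Prop :=
  compact A /\ polyhedron A.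

Definition sqnorm n (Q : 'M[R]_n) (x : 'cV[R]_n) : R := (x^T *m Q *m x) 0 0.

Definition posdef n (Q : 'M[R]_n) : Prop :=
  Q^T = Q /\ forall x : 'cV[R]_n, x != 0 -> 0 < sqnorm Q x.

End Generic.

(* f is a total function standing for a map defined on Xset x Uset:
   differentiability and convexity are assumed there only, and the algorithms
   below evaluate f at such points only. *)
Record setting (R : realType) (nx nu : nat) := Setting {
  f : 'cV[R]_nx -> 'cV[R]_nu -> 'cV[R]_nx;
  W : set 'cV[R]_nx;
  Xset : set 'cV[R]_nx;
  Uset : set 'cV[R]_nu;
  xr : nat -> 'cV[R]_nx;
  ur : nat -> 'cV[R]_nu;
  K : 'M[R]_(nu, nx);
  Qx : 'M[R]_nx;
  Ru : 'M[R]_nu;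
  QN : 'M[R]_nx;
  XN : set ('cV[R]_nx * 'cV[R]_nx)      (* pairs (lower, upper) of bounds *)
}.

Notation seed R nu N := ('I_N -> 'cV[R]_nu).

(* A tube of boxes, given by their bounds; stages are numbered 0, ..., N. *)
Record tube (R : realType) (nx N : nat) := Tube {
  lower : 'I_N.+1 -> 'cV[R]_nx;
  upper : 'I_N.+1 -> 'cV[R]_nx
}.

(* [lin_pt k j] is the minimizer x^0_{k|i,j} at which row j of [lin_A k] and
   [lin_B k] is computed. *)
Record linearization (R : realType) (nx nu N : nat) := Linearization {
  seed_tube : tube R nx N;
  lin_pt : 'I_N -> 'I_nx -> 'cV[R]_nx;
  lin_A : 'I_N -> 'M[R]_nx;
  lin_B : 'I_N -> 'M[R]_(nx, nu)
}.

Section MPC.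
Context {R : realType} {nx nu N : nat}.
Variable sys : setting R nx nu.

(* For k < N, the stages k and k + 1 of a tube. *)
Definition cur (k : 'I_N) : 'I_N.+1 := widen_ord (leqnSn N) k.
Definition nxt (k : 'I_N) : 'I_N.+1 := lift ord0 k.

Definition cross (T : tube R nx N) (k : 'I_N.+1) : set 'cV[R]_nx :=
  box (lower T k) (upper T k).

(* W is compact and nonempty, so that these are a maximum and a minimum. *)
Definition wmax (j : 'I_nx) : R := sup [set w j 0 | w in W sys].
Definition wmin (j : 'I_nx) : R := inf [set w j 0 | w in W sys].

Definition kappa (i : nat) (x : 'cV[R]_nx) : 'cV[R]_nu :=
  K sys *m (x - xr sys i) + ur sys i.

Definition standing : Prop :=
  [/\ compact (W sys) /\ W sys !=set0, compact_polytope (Xset sys),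
      compact_polytope (Uset sys)
    & forall i, xr sys i.+1 = f sys (xr sys i) (ur sys i)].

Definition assumption2 : Prop :=
  (forall z, (Xset sys `*` Uset sys) z ->
     differentiable (fun z : 'cV[R]_nx * 'cV[R]_nu => f sys z.1 z.2) z) /\
  (forall j, convex_function (Xset sys `*` Uset sys)
     (fun z : 'cV[R]_nx * 'cV[R]_nu => f sys z.1 z.2 j 0)).

(* The terminal ingredients of part (b).  The successor pair (lo', hi') may
   depend on (lo, hi), but not on i or on x. *)
Definition assumption4b : Prop :=
  forall lo hi, XN sys (lo, hi) ->
  [/\ forall i, (N <= i)%N -> box lo hi (xr sys i) /\ Uset sys (ur sys i),
      box lo hi `<=` Xset sys,
      exists lo' hi', XN sys (lo', hi') /\
        forall i x j, (N <= i)%N -> box lo hi x ->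
          f sys x (kappa i x) j 0 + wmax j <= hi' j 0 /\
          lo' j 0 <= f sys x (kappa i x) j 0 + wmin j
    & forall i x, (N <= i)%N -> box lo hi x -> Uset sys (kappa i x)].

(* The successor state x' is disturbed.  beta and (lo, hi) may depend on i,
   which is the weakest reading of the assumption. *)
Definition assumption4c : Prop :=
  [/\ posdef (Qx sys), posdef (Ru sys), posdef (QN sys)
    & forall i, (N <= i)%N ->
        exists beta lo hi, [/\ 0 <= beta, XN sys (lo, hi)
          & forall x w, box lo hi x -> W sys w ->
              let u := kappa i x in
              let x' := f sys x u + w in
              sqnorm (Qx sys) (x - xr sys i) + sqnorm (Ru sys) (u - ur sys i) - beta
              <= sqnorm (QN sys) (x - xr sys i)
                 - sqnorm (QN sys) (x' - xr sys i.+1)]].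

(* Row j holds the partial derivatives of the component j of f at the j-th
   linearization point (x j, u j). *)
Definition jac_x (x : 'I_nx -> 'cV[R]_nx) (u : 'I_nx -> 'cV[R]_nu) :
    'M[R]_nx :=
  \matrix_(j, l) 'D_(delta_mx l 0) (fun y => f sys y (u j) j 0) (x j).

Definition jac_u (x : 'I_nx -> 'cV[R]_nx) (u : 'I_nx -> 'cV[R]_nu) :
    'M[R]_(nx, nu) :=
  \matrix_(j, l) 'D_(delta_mx l 0) (fun v => f sys (x j) v j 0) (u j).

(* A relation, because the minimizers need not be unique.  The inclusion
   Xk x (K Xk + c0_k) <= Xset x Uset says that the values of f that are
   minimized and maximized are taken in the domain of f. *)
Definition seed_linearization (x : 'cV[R]_nx) (c0 : seed R nu N)
    (D : linearization R nx nu N) : Prop :=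
  cross (seed_tube D) ord0 = [set x] /\
  forall k : 'I_N,
    let Xk := cross (seed_tube D) (cur k) in
    let u y := K sys *m y + c0 k in
    let x0 := lin_pt D k in
    [/\ forall y, Xk y -> Xset sys y /\ Uset sys (u y),
        forall j, Xk (x0 j) /\
          forall y, Xk y -> f sys (x0 j) (u (x0 j)) j 0 <= f sys y (u y) j 0,
        lin_A D k = jac_x x0 (u \o x0) /\ lin_B D k = jac_u x0 (u \o x0),
        forall j, upper (seed_tube D) (nxt k) j 0
          = sup [set f sys y (u y) j 0 | y in Xk] + wmax j
      & forall j, lower (seed_tube D) (nxt k) j 0
          = f sys (x0 j) (u (x0 j)) j 0 + wmin j].

(* The suprema are maxima of continuous functions over the boxes of T, which
   are compact, and nonempty when T is feasible. *)
Definition rcmpc_cost (i : nat) (c0 c : seed R nu N) (T : tube R nx N) : R :=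
  sup [set sqnorm (QN sys) (x - xr sys (N + i)) | x in cross T ord_max] +
  \sum_(k < N) sup [set sqnorm (Qx sys) (x - xr sys (k + i)) +
                        sqnorm (Ru sys) (K sys *m x + c k + c0 k - ur sys (k + i))
                   | x in cross T (cur k)].

Definition rcmpc_feasible (x : 'cV[R]_nx) (c0 : seed R nu N)
    (D : linearization R nx nu N) (c : seed R nu N) (T : tube R nx N) : Prop :=
  [/\ forall k : 'I_N,
        [/\ cross T (cur k) `<=` Xset sys,
            [set K sys *m y + (c k + c0 k) | y in cross T (cur k)] `<=` Uset sys
          & forall y j, cross T (cur k) y ->
              let x0 := lin_pt D k j in
              let u0 := K sys *m x0 + c0 k in
              f sys y (K sys *m y + c k + c0 k) j 0 + wmax j
                <= upper T (nxt k) j 0 /\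
              lower T (nxt k) j 0
                <= f sys x0 u0 j 0
                   + ((lin_A D k + lin_B D k *m K sys) *m (y - x0)) j 0
                   + (lin_B D k *m c k) j 0 + wmin j],
      cross T ord0 = [set x]
    & XN sys (lower T ord_max, upper T ord_max)].

Definition rcmpc_optimal (i : nat) (x : 'cV[R]_nx) (c0 : seed R nu N)
    (D : linearization R nx nu N) (c : seed R nu N) (T : tube R nx N) : Prop :=
  rcmpc_feasible x c0 D c T /\
  forall c' T', rcmpc_feasible x c0 D c' T' ->
    rcmpc_cost i c0 c T <= rcmpc_cost i c0 c' T'.

(* Euclidean norm of the stacked vector (c_0, ..., c_{N-1}). *)
Definition seed_norm (c : seed R nu N) : R :=
  Num.sqrt (\sum_k \sum_l (c k l 0) ^+ 2).

Definition shift_seed (i : nat) (c : seed R nu N) : seed R nu N :=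
  fun k => if insub k.+1 is Some k' then c k'
           else ur sys (N + i) - K sys *m xr sys (N + i).

Section Algorithm.
Variables (maxiters : nat) (tol : R).
Variables (xinit : 'cV[R]_nx) (cinit : seed R nu N).
(* The output of the very first seed computation (time 0, iteration 0).  It is
   a parameter because minimizers are not unique and initial feasibility of
   RcMPC refers to that particular output. *)
Variable Dinit : linearization R nx nu N.

(* D is a possible output of the seed computation in iteration m of time i,
   started from state x and seed c0. *)
Definition alg_linearization (i m : nat) (x : 'cV[R]_nx) (c0 : seed R nu N)
    (D : linearization R nx nu N) : Prop :=
  if (i == 0%N) && (m == 0%N) then D = Dinit else seed_linearization x c0 D.

(* The state is measured exactly: the current state x itself is used to compute
   the seed tube, RcMPC and the input.
   [alg_reaches i m x c0]: some run of the algorithm, under some admissible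
   disturbances, starts iteration m (counted from 0) of time i with measured
   state x and seed c0.  Runs are partial, so nothing is assumed about what can
   be solved from there on. *)
Inductive alg_reaches : nat -> nat -> 'cV[R]_nx -> seed R nu N -> Prop :=
| alg_init : alg_reaches 0 0 xinit cinit
| alg_iterate i m x c0 D c T :
    alg_reaches i m x c0 -> alg_linearization i m x c0 D ->
    rcmpc_optimal i x c0 D c T ->
    (m.+1 < maxiters)%N -> tol <= seed_norm c ->
    alg_reaches i m.+1 x (c \+ c0)
| alg_advance i m x c0 D c T w (k0 : 'I_N) :
    alg_reaches i m x c0 -> alg_linearization i m x c0 D ->
    rcmpc_optimal i x c0 D c T ->
    m.+1 = maxiters \/ seed_norm c < tol ->
    W sys w -> k0 = 0%N :> nat ->
    alg_reaches i.+1 0 (f sys x (K sys *m x + (c \+ c0) k0) + w)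
      (shift_seed i (c \+ c0)).

End Algorithm.
End MPC.

Arguments assumption4b {R nx nu} N sys.
Arguments assumption4c {R nx nu} N sys.

(* Main.v *)
Require Import Defs.
From mathcomp Require Import all_boot all_order all_algebra.
From mathcomp Require Import all_classical all_reals all_analysis.
From mathcomp Require Import ring lra.

Set Implicit Arguments.
Unset Strict Implicit.
Unset Printing Implicit Defensive.

Import Order.TTheory GRing.Theory Num.Theory.
Import numFieldNormedType.Exports.

Local Open Scope classical_set_scope.
Local Open Scope ring_scope.

(** The lower bounds of a feasible tube are computed from linearizations of f,
    whose base points move with the seed.  A feasible tube is therefore not
    itself carried over to the next problem; what is carried over is the
    linearization-free property that it certifies.  Call a tube T robust for a
    state x and a seed c ([robust_tube]) when x lies in its first box, when
    under u = K y + c_k every point y of its k-th box is admissible and moves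
    into the next box whatever the disturbance, and when its last box is
    terminal.

    - Feasible implies robust ([feasible_robust]).  A tangent of a convex
      function lies below it, so the linearized lower bound is below the true
      dynamics.  Hence a feasible (c, T) for the seed c0 is a robust tube for
      the updated seed c + c0.

    - Robust implies feasible ([robust_feasible]).  The boxes of the seed tube
      are the tightest ones, so they lie inside those of T.  On the k-th box of
      the seed tube the base point minimizes the component f_j along the
      feedback policy; since the box is convex, the linearized increment from
      that minimizer to any other point of the box is nonnegative.  The
      linearized lower bound is then implied by the bound at the minimizer
      alone.  So the correction c = 0 and the boxes of the seed tube are
      feasible, provided the last box is replaced by that of T: a box inside a
      terminal box need not be terminal.

    - The seed computation succeeds as soon as a robust tube exists
      ([seed_output_correct]), since all the extrema are then taken over
      nonempty compact boxes on which f is continuous.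

    - At a time step ([robust_shift]) the tube is shifted by one stage and
      completed by the successor that the terminal ingredients provide, the
      shifted seed being completed by the terminal control law.

    Every state and seed reached after the first solution of the problem thus
    has a robust tube ([alg_reaches_robust]), and at the first iteration
    feasibility is assumed. *)

(** * Directional derivatives of convex functions and at minimizers *)

(** Only step sizes t > 0 matter: the points of interest may lie on the boundary
    of the domain of convexity, or of the box of minimization, so that nothing
    is known on the other side. *)
Lemma derive_ge_right (R : realType) (V : normedModType R) (F : V -> R)
    (z v : V) (a : R) :
  derivable F z v ->
  (forall t, 0 < t <= 1 -> t * a <= F (t *: v + z) - F z) ->
  a <= 'D_v F z.
Proof.
move=> dF Fa; rewrite /derive.
have cF := cvg_dnbhs_at_right dF.
rewrite cvg_at_rightE//; apply: limr_ge; first by apply/cvg_ex; eexists; exact: cF.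
near=> t.
have t0 : 0 < t by near: t; exact: nbhs_right_gt.
have t1 : t <= 1 by near: t; exact: nbhs_right_le.
by rewrite /= /GRing.scale/= ler_pdivlMl// Fa// t0.
Unshelve. all: by end_near. Qed.

(** The previous bound for -F: by convexity, the difference quotients of F along
    the segment to z' are at most the total increment. *)
Lemma convex_tangent_le (R : realType) (V : normedModType R) (D : set V)
    (F : V -> R) (z z' : V) :
  convex_function (D : set (convex_lmodType V)) F -> D z -> D z' ->
  derivable F z (z' - z) -> F z + 'D_(z' - z) F z <= F z'.
Proof.
move=> cF Dz Dz' dF.
suff : F z - F z' <= 'D_(z' - z) (- F) z.
  by rewrite deriveN// lerBlDr addrC lerBrDr.
apply: derive_ge_right; first exact: derivableN.
move=> t /andP[/ltW t0 t1]; have opp_fctE y : (- F) y = - F y by []; rewrite !opp_fctE.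
have := cF (Itv01 t0 t1) z' z (mem_set Dz') (mem_set Dz).
rewrite convRE /conv/=.
(* p and q are the point of parameter t of the segment, written in the two
   forms used by convexity and by the derivative. *)
set p := _ + _; set q := (X in _ -> _ <= - F X - _).
have -> : p = q.
  rewrite /p /q scalerBr /unstable.onem scalerBl scale1r -addrA; congr (_ + _).
  by rewrite addrC.
rewrite /unstable.onem.
move: (F z) (F z') (F q) => b c d.
move=> h; have {}h : (d <= t * c + (1 - t) * b) by exact: h.
lra.
Qed.

(** Functions on different spaces are compared along lines, to identify the
    partial derivatives of a function of two variables with directional
    derivatives on the product. *)
Lemma eq_derive_line (R : numFieldType) (V V' W : normedModType R)
    (F : V -> W) (G : V' -> W) (x v : V) (x' v' : V') :
  (forall h : R, F (h *: v + x) = G (h *: v' + x')) ->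
  'D_v F x = 'D_v' G x'.
Proof.
move=> FG; have := FG 0; rewrite !scale0r !add0r => FG0; rewrite /derive.
suff -> : (fun h : R => h^-1 *: ((F \o shift x) (h *: v) - F x)) =
          (fun h => h^-1 *: ((G \o shift x') (h *: v') - G x')) by [].
by apply/funext => h /=; rewrite FG FG0.
Qed.

Section Gradient.
Context {R : realType} {nx nu : nat}.
Variable sys : setting R nx nu.

(** A component of f as one function on the product of states and inputs, where
    differentiability and convexity are assumed. *)
Definition fpair (j : 'I_nx) (z : 'cV[R]_nx * 'cV[R]_nu) : R :=
  f sys z.1 z.2 j 0.

(** Row j of the two Jacobians is taken at the j-th linearization point, so each
    row of the linearized model is a directional derivative of one component. *)
Lemma jacobianE (x : 'I_nx -> 'cV[R]_nx) (u : 'I_nx -> 'cV[R]_nu) v w j :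
  differentiable (fpair j) (x j, u j) ->
  (jac_x sys x u *m v + jac_u sys x u *m w) j 0 = 'D_(v, w) (fpair j) (x j, u j).
Proof.
move=> df.
have Ex l : jac_x sys x u j l = 'd (fpair j) (x j, u j) (delta_mx l 0, 0).
  rewrite mxE -deriveE//; apply: eq_derive_line => h.
  by rewrite /fpair/= scaler0 add0r.
have Eu l : jac_u sys x u j l = 'd (fpair j) (x j, u j) (0, delta_mx l 0).
  rewrite mxE -deriveE//; apply: eq_derive_line => h.
  by rewrite /fpair/= scaler0 add0r.
have pair_suml (a : 'I_nx -> 'cV[R]_nx) :
    (\sum_l a l, 0 : 'cV[R]_nu) = \sum_l (a l, 0).
  apply: (big_morph (fun y : 'cV[R]_nx => (y, 0 : 'cV[R]_nu)) (id1 := 0)) => //.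
  by move=> y y'; congr (_, _); rewrite addr0.
have pair_sumr (a : 'I_nu -> 'cV[R]_nu) :
    (0 : 'cV[R]_nx, \sum_l a l) = \sum_l (0, a l).
  apply: (big_morph (fun y : 'cV[R]_nu => (0 : 'cV[R]_nx, y)) (id1 := 0)) => //.
  by move=> y y'; congr (_, _); rewrite addr0.
have -> : (v, w) = \sum_l v l 0 *: (delta_mx l 0, 0)
                 + \sum_l w l 0 *: (0, delta_mx l 0).
  have -> : (v, w) = (v, 0) + (0, w) by congr (_, _); rewrite /= ?addr0 ?add0r.
  rewrite [in LHS](matrix_sum_delta v) [in LHS](matrix_sum_delta w).
  rewrite pair_suml pair_sumr; congr (_ + _); apply: eq_bigr => l _;
    by rewrite big_ord1; congr (_, _); rewrite /= scaler0.
rewrite deriveE// linearD !linear_sum !mxE; congr (_ + _); apply: eq_bigr => l _.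
  by rewrite linearZ/= Ex mulrC.
by rewrite linearZ/= Eu mulrC.
Qed.
End Gradient.

(** * Matrix products and boxes *)

Lemma differentiable_mulmx (R : realFieldType) (m n : nat) (M : 'M[R]_(m, n))
    (y : 'cV[R]_n) : differentiable (fun z : 'cV[R]_n => M *m z) y.
Proof.
have -> : (fun z : 'cV[R]_n => M *m z) =
    \sum_l (fun z : 'cV[R]_n => z l 0 *: col l M).
  apply/funext => z; rewrite fct_sumE; apply/colP => i.
  by rewrite summxE mxE; apply: eq_bigr => l _; rewrite !mxE mulrC.
apply: differentiable_sum => l; apply: differentiableZl.
exact: differentiable_coord.
Qed.

Lemma closed_box (R : realType) (n : nat) (lo hi : 'cV[R]_n) :
  closed (box lo hi).
Proof.
have -> : box lo hi = \bigcap_(j in setT)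
    ((fun x : 'cV[R]_n => x j 0) @^-1` [set r | lo j 0 <= r] `&`
     (fun x : 'cV[R]_n => x j 0) @^-1` [set r | r <= hi j 0]).
  apply/seteqP; split => [x bx j _|x bx j]; first by have /andP[] := bx j.
  by have [/= -> ->] := bx j Logic.I.
apply: closed_bigI => j _; apply: closedI; apply: preimage_closed => [z _|].
- exact: coord_continuous.
- exact: closed_ge.
- exact: coord_continuous.
- exact: closed_le.
Qed.

Lemma box_segment (R : realType) (n : nat) (lo hi : 'cV[R]_n) x y (t : R) :
  0 <= t <= 1 -> box lo hi x -> box lo hi y -> box lo hi (t *: (y - x) + x).
Proof.
move=> /andP[t0 t1] bx By j.
have /andP[lx xh] := bx j; have /andP[ly yh] := By j; rewrite !mxE.
have -> : t * (y j 0 - x j 0) + x j 0 = (1 - t) * x j 0 + t * y j 0 by ring.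
have t1' : 0 <= 1 - t by rewrite subr_ge0.
have {1}-> : lo j 0 = (1 - t) * lo j 0 + t * lo j 0 by ring.
have -> : hi j 0 = (1 - t) * hi j 0 + t * hi j 0 by ring.
by apply/andP; split; apply: lerD; exact: ler_wpM2l.
Qed.

(** * The system under the feedback policy *)

Section Invariant.
Context {R : realType} {nx nu N : nat}.
Variable sys : setting R nx nu.

Definition drift (c : 'cV[R]_nu) (y : 'cV[R]_nx) : 'cV[R]_nx :=
  f sys y (K sys *m y + c).

Definition admissible (c : 'cV[R]_nu) (B : set 'cV[R]_nx) : Prop :=
  forall y, B y -> Xset sys y /\ Uset sys (K sys *m y + c).

Lemma w_bounds w j : compact (W sys) -> W sys w ->
  wmin sys j <= w j 0 <= wmax sys j.
Proof.
move=> cW Ww.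
have cWj : compact [set z j 0 | z in W sys].
  apply: (continuous_compact (f := fun z : 'cV[R]_nx => z j 0)) cW.
  by apply: continuous_subspaceT => z; exact: coord_continuous.
have [M [_ MW]] := compact_bounded cWj.
have MW' z : W sys z -> `|z j 0| <= M + 1.
  by move=> Wz; apply: (MW (M + 1)); [rewrite ltrDl|exists z].
apply/andP; split.
- apply: ge_inf; last by exists w.
  exists (- (M + 1)) => _ [z Wz <-]; have := MW' z Wz; rewrite ler_norml.
  by case/andP.
- apply: ub_le_sup; last by exists w.
  exists (M + 1) => _ [z Wz <-]; have := MW' z Wz; rewrite ler_norml.
  by case/andP.
Qed.

Lemma fpair_differentiable x u j : assumption2 sys -> Xset sys x -> Uset sys u ->
  differentiable (fpair sys j) (x, u).
Proof.
move=> [df _] Xx Uu.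
have := df (x, u) (conj Xx Uu) => d.
exact: (differentiable_comp d (differentiable_coord _ _ _)).
Qed.

Lemma drift_continuous c B j : assumption2 sys -> admissible c B ->
  {within B, continuous (fun y => drift c y j 0)}.
Proof.
move=> A2 adm; rewrite continuous_subspace_in => y /set_mem By.
have [Xy Uy] := adm y By.
apply: continuous_subspaceT_for => //.
have -> : (fun y => drift c y j 0) = fpair sys j \o (fun y => (y, K sys *m y + c)).
  by [].
apply: differentiable_continuous; apply: differentiable_comp.
  apply: differentiable_pair => //; apply: differentiableD => //.
  exact: differentiable_mulmx.
exact: fpair_differentiable.
Qed.

(** First-order optimality: the box is convex, so the segment from the minimizer
    to y stays in it, and the drift nowhere falls below its initial value along
    that segment. *)
Lemma argmin_gradient_ge0 lo hi c (x : 'I_nx -> 'cV[R]_nx) (j : 'I_nx) y :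
  let u := (fun z => K sys *m z + c) in
  assumption2 sys -> admissible c (box lo hi) ->
  box lo hi (x j) ->
  (forall y, box lo hi y -> drift c (x j) j 0 <= drift c y j 0) ->
  box lo hi y ->
  0 <= ((jac_x sys x (u \o x) + jac_u sys x (u \o x) *m K sys) *m (y - x j)) j 0.
Proof.
move=> u A2 adm Bx xmin By; have [Xx Ux] := adm _ Bx.
have df : differentiable (fpair sys j) (x j, (u \o x) j).
  exact: fpair_differentiable.
rewrite mulmxDl -mulmxA jacobianE//; apply: derive_ge_right.
  exact: diff_derivable.
move=> t /andP[/ltW t0 t1]; rewrite mulr0 subr_ge0.
have Bt : box lo hi (t *: (y - x j) + x j) by apply: box_segment; rewrite ?t0.
have := xmin _ Bt; congr (_ <= _); rewrite /drift /fpair/=; congr (f sys _ _ j 0).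
by rewrite mulmxDr -scalemxAr addrA.
Qed.

Lemma tangent_le (x : 'I_nx -> 'cV[R]_nx) (u : 'I_nx -> 'cV[R]_nu) j x' u' :
  assumption2 sys -> Xset sys (x j) -> Uset sys (u j) ->
  Xset sys x' -> Uset sys u' ->
  f sys (x j) (u j) j 0
    + (jac_x sys x u *m (x' - x j) + jac_u sys x u *m (u' - u j)) j 0
    <= f sys x' u' j 0.
Proof.
move=> A2 Xx Ux Xx' Ux'.
have df := fpair_differentiable j A2 Xx Ux.
rewrite jacobianE//; have [_ /(_ j) cvx] := A2.
have := convex_tangent_le cvx (conj Xx Ux : (Xset sys `*` Uset sys) (x j, u j))
  (conj Xx' Ux' : (Xset sys `*` Uset sys) (x', u')).
by apply; exact: diff_derivable.
Qed.

(** * Robust tubes and the linearized constraints *)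

Definition step_within (c : 'cV[R]_nu) (B : set 'cV[R]_nx) (lo hi : 'cV[R]_nx) :=
  forall y j, B y -> lo j 0 <= drift c y j 0 + wmin sys j /\
                     drift c y j 0 + wmax sys j <= hi j 0.

(** The constraints of the problem for a zero correction, with the exact dynamics
    in place of the linearization.  The first box need not be reduced to the
    state: after a shift it is a box of the previous tube, of which the new
    state is some point. *)
Definition robust_tube (x : 'cV[R]_nx) (c : seed R nu N) (T : tube R nx N) :=
  [/\ cross T ord0 x,
      forall k, admissible (c k) (cross T (cur k)),
      forall k, step_within (c k) (cross T (cur k))
                            (lower T (nxt k)) (upper T (nxt k))
    & XN sys (lower T ord_max, upper T ord_max)].

Lemma stage_ind (P : 'I_N.+1 -> Prop) :
  P ord0 -> (forall k : 'I_N, P (cur k) -> P (nxt k)) -> forall k, P k.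
Proof.
move=> P0 PS [k]; elim: k => [|k IH] kN.
  by rewrite (_ : Ordinal kN = ord0)//; exact: val_inj.
rewrite (_ : Ordinal kN = nxt (Ordinal (kN : (k < N)%N))); last exact: val_inj.
by apply: PS; rewrite (_ : cur _ = Ordinal (ltnW kN)); [exact: IH|exact: val_inj].
Qed.

(** Where convexity enters: the tangent at the old linearization point, evaluated
    at the corrected input, bounds the exact dynamics from below. *)
Lemma feasible_robust x c0 D c T : assumption2 sys ->
  seed_linearization sys x c0 D -> rcmpc_feasible sys x c0 D c T ->
  robust_tube x (c \+ c0) T.
Proof.
move=> A2 [_ HD] [Hk T0 TN]; split => //.
- by rewrite T0.
- move=> k y Ty; have [TX TU _] := Hk k; split; first exact: TX.
  by apply: TU; exists y.
- move=> k y j Ty; have [TX TU /(_ y j Ty)/=] := Hk k.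
  have [adm xmin [-> ->] _ _] := HD k; rewrite -addrA -/(drift (c k + c0 k) y).
  move=> [hup hlo]; split; last exact: hup.
  apply: le_trans hlo _; rewrite lerD2r.
  have [x0B _] := xmin j; have [Xx0 Ux0] := adm _ x0B.
  have Xy := TX _ Ty; have Uy : Uset sys (K sys *m y + (c k + c0 k)).
    by apply: TU; exists y.
  have := tangent_le (x := lin_pt D k)
    (u := (fun z => K sys *m z + c0 k) \o lin_pt D k) A2 Xx0 Ux0 Xy Uy.
  apply: le_trans; rewrite -addrA lerD2l /=.
  have -> : K sys *m y + (c k + c0 k) - (K sys *m lin_pt D k j + c0 k) =
            K sys *m (y - lin_pt D k j) + c k.
    by rewrite mulmxBr addrA opprD addrACA subrr addr0 addrAC.
  by rewrite mulmxDl mulmxDr -mulmxA addrA [in leRHS]mxE.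
Qed.

(** The lower bounds are attained in B and the upper ones are suprema over B, so
    a box that contains all successors of B cannot be smaller. *)
Lemma tight_box_sub c B (x0 : 'I_nx -> 'cV[R]_nx)
    (lo hi lo' hi' : 'cV[R]_nx) :
  (forall j, B (x0 j)) -> step_within c B lo' hi' ->
  (forall j, lo j 0 = drift c (x0 j) j 0 + wmin sys j) ->
  (forall j, hi j 0 = sup [set drift c y j 0 | y in B] + wmax sys j) ->
  box lo hi `<=` box lo' hi'.
Proof.
move=> Bx0 stp lo_eq hi_eq y By j; have /andP[ly yh] := By j.
have [l0 _] := stp _ j (Bx0 j); apply/andP; split.
  by apply: le_trans ly; rewrite lo_eq.
apply: (le_trans yh); rewrite hi_eq -lerBrDr; apply: ge_sup.
  by exists (drift c (x0 j) j 0); exists (x0 j).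
by move=> _ [z Bz <-]; rewrite lerBrDr; have [] := stp _ j Bz.
Qed.

Lemma drift_le_sup c B j lo hi y : step_within c B lo hi -> B y ->
  drift c y j 0 <= sup [set drift c z j 0 | z in B].
Proof.
move=> stp By; apply: ub_le_sup; last by exists y.
by exists (hi j 0 - wmax sys j) => _ [z Bz <-]; rewrite lerBrDr; have [] := stp _ j Bz.
Qed.

Lemma step_withinW c B B' lo hi : B `<=` B' ->
  step_within c B' lo hi -> step_within c B lo hi.
Proof. by move=> BB' stp y j /BB'; exact: stp. Qed.

Lemma seed_tube_sub x c T D : robust_tube x c T -> seed_linearization sys x c D ->
  forall k, cross (seed_tube D) k `<=` cross T k.
Proof.
move=> [T0 _ stp _] [D0 HD]; apply: stage_ind; first by rewrite D0 => _ ->.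
move=> k sub; have [_ xmin _ hi_eq lo_eq] := HD k.
apply: (tight_box_sub _ (step_withinW sub (stp k)) lo_eq hi_eq).
by move=> j; have [] := xmin j.
Qed.

(** The zero correction works on the boxes of the seed tube: there the base
    points are minimizers, so the linearized increments are nonnegative.  On the
    larger boxes of T they may be negative, hence the passage to the seed tube;
    its last box, which may fail to be terminal, is replaced by that of T. *)
Lemma robust_feasible x c T D : (0 < N)%N -> assumption2 sys ->
  robust_tube x c T -> seed_linearization sys x c D ->
  exists T', rcmpc_feasible sys x c D (fun=> 0) T'.
Proof.
move=> N0 A2 rT sD; have sub := seed_tube_sub rT sD.
have [T0 _ stp TN] := rT; have [D0 HD] := sD.
pose bnd g (k : 'I_N.+1) : 'cV[R]_nx :=
  g (if k == ord_max then T else seed_tube D) k.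
exists (Tube (bnd (@lower _ _ _)) (bnd (@upper _ _ _))).
have cur_neq (k : 'I_N) : (cur k == ord_max) = false.
  by apply/negbTE; rewrite -val_eqE /= neq_ltn ltn_ord.
have crE k : cross (Tube (bnd (@lower _ _ _)) (bnd (@upper _ _ _))) (cur k) =
             cross (seed_tube D) (cur k).
  by rewrite /cross /bnd/= cur_neq.
split.
- move=> k; rewrite crE.
  have [adm xmin [-> ->] hi_eq lo_eq] := HD k; split.
  + by move=> y /adm[].
  + by move=> _ [y /adm[_ Uy] <-]; rewrite add0r.
  + move=> y j Xy /=; rewrite addr0 mulmx0 [(0 : 'cV_nx) j 0]mxE addr0.
    have [Xx0 x0min] := xmin j.
    have grad := argmin_gradient_ge0 (x := lin_pt D k) A2 adm Xx0 x0min Xy.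
    have stpk := step_withinW (sub (cur k)) (stp k).
    split.
    * rewrite /bnd; case: ifP => _; first by have [] := stpk y j Xy.
      rewrite hi_eq lerD2r.
      exact: (drift_le_sup _ stpk Xy).
    * rewrite addrAC; apply: ler_wpDr; first exact: grad.
      rewrite /bnd; case: ifP => _; first by have [] := stpk _ j Xx0.
      by rewrite lo_eq.
- rewrite -D0 /cross /bnd/=.
  by rewrite (_ : (ord0 == ord_max) = false)// -val_eqE/=; case: N N0.
- by rewrite /bnd/= eqxx.
Qed.

(** * Existence of a seed linearization *)

Definition argmin_pt c lo hi (j : 'I_nx) : 'cV[R]_nx :=
  xget 0 [set z | box lo hi z /\
                  forall y, box lo hi y -> drift c z j 0 <= drift c y j 0].

Definition seed_step (c : 'cV[R]_nu) (b : 'cV[R]_nx * 'cV[R]_nx) :=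
  (\col_j (drift c (argmin_pt c b.1 b.2 j) j 0 + wmin sys j),
   \col_j (sup [set drift c y j 0 | y in box b.1 b.2] + wmax sys j)).

(** The default value 0 of the seed is never read at the stages k <= N of a tube. *)
Definition seed_bounds (x : 'cV[R]_nx) (c : seed R nu N) : nat -> _ :=
  fix F k := if k is k'.+1 then seed_step (oapp c 0 (insub k')) (F k') else (x, x).

Definition seed_output (x : 'cV[R]_nx) (c : seed R nu N) :=
  let T := Tube (fun k : 'I_N.+1 => (seed_bounds x c k).1)
                (fun k : 'I_N.+1 => (seed_bounds x c k).2) in
  let x0 k := argmin_pt (c k) (lower T (cur k)) (upper T (cur k)) in
  let u0 k j := K sys *m x0 k j + c k in
  Linearization T x0 (fun k => jac_x sys (x0 k) (u0 k))
                     (fun k => jac_u sys (x0 k) (u0 k)).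

Lemma argmin_ptP c lo hi j : assumption2 sys -> compact (Xset sys) ->
  admissible c (box lo hi) -> box lo hi !=set0 ->
  box lo hi (argmin_pt c lo hi j) /\
  forall y, box lo hi y -> drift c (argmin_pt c lo hi j) j 0 <= drift c y j 0.
Proof.
move=> A2 cX adm B0.
have cB : compact (box lo hi).
  by apply: subclosed_compact cX _; [exact: closed_box|move=> y /adm[]].
have [z zB zmin] := compact_EVT_min B0 cB (drift_continuous (j := j) A2 adm).
apply: (xgetPex 0 (P := [set z | box lo hi z /\ _])); exists z; split.
  exact: set_mem.
by move=> y yB; apply: zmin; exact: mem_set.
Qed.

(** The robust tube encloses the boxes computed so far.  This keeps them inside
    the compact admissible set, so that the next minimizers exist, and bounds
    the suprema from above, so that the next box is nonempty. *)
Lemma seed_output_correct x c T : standing sys -> assumption2 sys ->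
  robust_tube x c T -> seed_linearization sys x c (seed_output x c).
Proof.
move=> [[cW [w Ww]] [cX _] _ _] A2 [T0 adm stp _].
set D := seed_output x c; set S := seed_tube D.
have S0 : cross S ord0 = [set x].
  apply/seteqP; split => [y yx|_ -> j]; last by rewrite /= lexx.
  by apply/colP => j; apply/eqP; rewrite eq_sym eq_le; exact: yx.
have nextE (k : 'I_N) : (lower S (nxt k), upper S (nxt k)) =
    seed_step (c k) (lower S (cur k), upper S (cur k)).
  transitivity (seed_bounds x c (nxt k)); first by rewrite -surjective_pairing.
  by rewrite lift0 /= valK.
have loE k j : lower S (nxt k) j 0 =
    drift (c k) (lin_pt D k j) j 0 + wmin sys j.
  by have := congr1 (fun b : 'cV[R]_nx * 'cV[R]_nx => b.1 j 0) (nextE k) => /= ->; rewrite mxE.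
have hiE k j : upper S (nxt k) j 0 =
    sup [set drift (c k) y j 0 | y in cross S (cur k)] + wmax sys j.
  by have := congr1 (fun b : 'cV[R]_nx * 'cV[R]_nx => b.2 j 0) (nextE k) => /= ->; rewrite mxE.
have [subT S_ne] : (forall k, cross S k `<=` cross T k) /\
                   (forall k, cross S k !=set0).
  apply/all_and2; apply: stage_ind; first by rewrite S0; split => [_ ->|]; last exists x.
  move=> k [sub Sk0].
  have admS : admissible (c k) (cross S (cur k)) by move=> y /sub/(adm k).
  have xmin j := argmin_ptP j A2 cX admS Sk0.
  have stpS := step_withinW sub (stp k).
  split.
    apply: (tight_box_sub (x0 := lin_pt D k) _ stpS (loE k) (hiE k)).
    by move=> j; have [] := xmin j.
  exists (lower S (nxt k)) => j; rewrite lexx/= loE hiE; apply: lerD.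
    by apply: (drift_le_sup _ stpS); have [] := xmin j.
  by have /andP[/le_trans] := w_bounds j cW Ww; apply.
have admS k : admissible (c k) (cross S (cur k)) by move=> y /subT/(adm k).
split => // k; split => //; first exact: admS.
by move=> j; exact: (argmin_ptP j A2 cX (admS k) (S_ne (cur k))).
Qed.

(** * Propagation along the algorithm *)

(** Stage k of the new tube is stage k + 1 of the old one.  At the last step the
    appended input makes the policy coincide with the terminal control law, under
    which the terminal box moves into its successor pair. *)
Lemma robust_shift i x c T w (k0 : 'I_N) :
  compact (W sys) -> assumption4b N sys ->
  robust_tube x c T -> W sys w -> k0 = 0%N :> nat ->
  exists T', robust_tube (drift (c k0) x + w) (shift_seed sys i c) T'.
Proof.
move=> cW A4 [T0 adm stp TN] Ww k00.
have [_ TX [lo' [hi' [TN' stpN]]] TU] := A4 _ _ TN.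
pose T' := Tube (fun k : 'I_N.+1 => oapp (lower T) lo' (insub k.+1))
                (fun k : 'I_N.+1 => oapp (upper T) hi' (insub k.+1)).
have T'S (k : 'I_N.+1) (k' : 'I_N.+1) : k' = k.+1 :> nat ->
    lower T' k = lower T k' /\ upper T' k = upper T k'.
  move=> kk'; rewrite /T'/= -kk' insubT//= => lt.
  by rewrite (_ : Sub _ _ = k')//; exact: val_inj.
have T'N : lower T' ord_max = lo' /\ upper T' ord_max = hi'.
  by rewrite /T'/= insubF//= ltnn.
have T'cur (k : 'I_N) : cross T' (cur k) = cross T (nxt k).
  by rewrite /cross; have [|-> ->] := T'S (cur k) (nxt k).
exists T'.
have stage (k : 'I_N) :
  admissible (shift_seed sys i c k) (cross T' (cur k)) /\
  step_within (shift_seed sys i c k) (cross T' (cur k))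
     (lower T' (nxt k)) (upper T' (nxt k)).
  rewrite T'cur /shift_seed; case: insubP => [k' _ k'E|kN].
    have -> : nxt k = cur k' by apply: ord_inj; rewrite lift0 /= k'E.
    have [|-> ->] := T'S (cur k') (nxt k'); first by [].
    by split; [exact: adm|exact: stp].
  have kmax : nxt k = ord_max.
    by apply: ord_inj; rewrite lift0; apply/eqP; rewrite eqn_leq ltn_ord leqNgt.
  rewrite kmax; have [-> ->] := T'N.
  have kappaE y : K sys *m y + (ur sys (N + i) - K sys *m xr sys (N + i)) =
                  kappa sys (N + i) y.
    by rewrite /kappa mulmxBr addrA addrAC.
  split => y.
    by move=> Ty; rewrite kappaE; split; [exact: TX|exact: TU (leq_addr _ _) Ty].
  move=> j Ty; rewrite /drift kappaE.
  by have [? ?] := stpN (N + i)%N y j (leq_addr _ _) Ty.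
split.
- have -> : cross T' ord0 = cross T (nxt k0).
    by rewrite -T'cur; congr (cross T'); apply: val_inj; rewrite /= k00.
  move=> j; rewrite mxE.
  have T0' : cross T (cur k0) x.
    by rewrite (_ : cur k0 = ord0)//; apply: val_inj; rewrite /= k00.
  have [lo_le hi_ge] := stp k0 x j T0'; have /andP[w1 w2] := w_bounds j cW Ww.
  by apply/andP; split; [apply: le_trans lo_le _|apply: le_trans _ hi_ge];
    rewrite lerD2l.
- by move=> k; have [] := stage k.
- by move=> k; have [] := stage k.
- by have [-> ->] := T'N.
Qed.

(** The initial iteration is set apart: the feasible solution assumed there
    refers to the given output of the seed computation, and its robust tube is
    one for the updated seed, not for the initial one. *)
Lemma alg_reaches_robust maxiters tol xinit cinit Dinit i m x c0 :
  standing sys -> assumption2 sys -> assumption4b N sys ->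
  seed_linearization sys xinit cinit Dinit ->
  alg_reaches sys maxiters tol xinit cinit Dinit i m x c0 ->
  if (i == 0%N) && (m == 0%N) then x = xinit /\ c0 = cinit
  else exists T, robust_tube x c0 T.
Proof.
move=> st A2 A4 sD.
have lin i' m' x' c' D :
    (if (i' == 0%N) && (m' == 0%N) then x' = xinit /\ c' = cinit
     else exists T, robust_tube x' c' T) ->
    alg_linearization sys Dinit i' m' x' c' D -> seed_linearization sys x' c' D.
  by rewrite /alg_linearization; case: ifP => // _ [-> ->] ->.
have [[cW _] _ _ _] := st.
elim => {i m x c0} [//|i m x c0 D c T _ IH aD [feas _] _ _|
                   i m x c0 D c T w k0 _ IH aD [feas _] _ Ww k00].
  rewrite andbF; exists T.
  exact: feasible_robust A2 (lin _ _ _ _ _ IH aD) feas.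
have rT := feasible_robust A2 (lin _ _ _ _ _ IH aD) feas.
exact: robust_shift cW A4 rT Ww k00.
Qed.

End Invariant.

Theorem theorem5 (R : realType) (nx nu N : nat) (sys : setting R nx nu)
    (maxiters : nat) (tol : R)
    (xinit : 'cV[R]_nx) (cinit : seed R nu N)
    (Dinit : linearization R nx nu N) :
  (0 < N)%N -> (0 < maxiters)%N ->
  standing sys -> assumption2 sys -> assumption4b N sys ->
  assumption4c N sys ->
  seed_linearization sys xinit cinit Dinit ->
  (exists c T, rcmpc_feasible sys xinit cinit Dinit c T) ->
  forall (i m : nat) (x : 'cV[R]_nx) (c0 : seed R nu N),
    alg_reaches sys maxiters tol xinit cinit Dinit i m x c0 ->
    (exists D, alg_linearization sys Dinit i m x c0 D) /\
    (forall D, alg_linearization sys Dinit i m x c0 D ->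
       exists c T, rcmpc_feasible sys x c0 D c T).
Proof.
move=> N0 _ st A2 A4 _ sD feas0 i m x c0 reach.
have := alg_reaches_robust st A2 A4 sD reach; rewrite /alg_linearization.
case: ifP => _ => [[-> ->]|[T rT]].
  by split => [|D ->]; [exists Dinit|].
split => [|D sD']; first by exists (seed_output sys x c0); exact: seed_output_correct rT.
by have [T' feas] := robust_feasible N0 A2 rT sD'; exists (fun=> 0), T'.
Qed.
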